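(* Let $q$ be a fixed natural number. For every natural number $n$, $$u_q(n)=\begin{cases}0,&\text{if } n<q,\\ 1,&\text{if } n=q,\\ u_q(n-1)+u_q(n-q),&\text{if } n>q.\end{cases}$$
   Context: Natural numbers are positive integers. A composition of a natural number $n$ is an ordered finite sequence $(a_1,\dots,a_k)$, $k\ge 1$, of natural numbers (called its parts) with $n=a_1+a_2+\cdots+a_k$; sequences differing in order are different compositions. For natural numbers $q$ and $n$, $u_q(n)$ denotes the number of compositions of $n$ all of whose parts are greater than or equal to $q$. *)

(* Defs.v *)
From HB Require Import structures.
From mathcomp Require Import all_boot.

Set Implicit Arguments.
Unset Strict Implicit.
Unset Printing Implicit Defensive.

Definition is_composition (n : nat) (s : seq nat) : bool :=
  [&& s != [::], all (fun a => 0 < a) s & sumn s == n].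

Record composition (n : nat) := Composition {
  parts :> seq nat;
  _ : is_composition n parts
}.

HB.instance Definition _ n := [isSub for @parts n].
HB.instance Definition _ n := [Countable of composition n by <:].

Lemma size_composition n (c : composition n) : size c <= n.
Proof.
case: c => s /= /and3P[_ s_gt0 /eqP <-].
elim: s s_gt0 => //= a s IHs /andP[a_gt0 /IHs le_s].
by rewrite -add1n leq_add.
Qed.

Lemma part_composition n (c : composition n) a : a \in (c : seq nat) -> a <= n.
Proof.
case: c => s /= /and3P[_ _ /eqP <-].
elim: s => //= b s IHs; rewrite inE => /predU1P[-> | /IHs le_a].
  exact: leq_addr.
exact: leq_trans le_a (leq_addl _ _).
Qed.

(* A composition of n has at most n parts, each at most n, so compositions of n
   embed in the finite type of sequences of length <= n over 'I_n.+1. *)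
Definition composition_code n (c : composition n) : n.-bseq 'I_n.+1 :=
  insub_bseq n [seq inord a | a <- (c : seq nat)].

Definition composition_decode n (t : n.-bseq 'I_n.+1) : option (composition n) :=
  insub [seq val i | i <- t].

Lemma composition_codeK n :
  pcancel (@composition_code n) (@composition_decode n).
Proof.
move=> c; rewrite /composition_decode.
suff -> : [seq val i | i <- composition_code c] = val c by rewrite valK.
rewrite /composition_code insubdK; last first.
  by rewrite unfold_in size_map size_composition.
rewrite -map_comp map_id_in // => a a_c /=.
by rewrite inordK // ltnS (part_composition a_c).
Qed.

HB.instance Definition _ n : isFinite (composition n) :=
  PCanIsFinite (@composition_codeK n).

Definition u (q n : nat) : nat :=
  #|[set c : composition n | all (fun a => q <= a) c]|.

(* Main.v *)
Require Import Defs.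
From mathcomp Require Import all_boot zify.

(* A composition of n > q with parts >= q and first part a either has a = q,
   and removing that part leaves such a composition of n - q, nonempty since
   n > q; or it has a > q, and lowering a by one gives such a composition of
   n - 1. Both maps are bijective. *)

Definition composition_geq (q n : nat) (s : seq nat) : bool :=
  is_composition n s && all (leq q) s.

(** Parts at least [q] are positive because [q] is, so the positivity test is absorbed. *)
Lemma composition_geqE q n s : 0 < q ->
  composition_geq q n s = [&& s != [::], all (leq q) s & sumn s == n].
Proof.
move=> q_gt0; rewrite /composition_geq /is_composition.
have [s_ge|] := boolP (all (leq q) s); last by rewrite !andbF.
have -> : all (leq 1) s by apply: sub_all s_ge => a; apply: leq_trans.
by rewrite andbT.
Qed.

(** Plain lists give compositions of different numbers one common type, so parts can be altered
    freely. *)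
Definition compositions_geq (q n : nat) : seq (seq nat) :=
  [seq parts c | c <- enum [set c : composition n | all (leq q) c]].

Lemma size_compositions_geq q n : size (compositions_geq q n) = u q n.
Proof. by rewrite size_map -cardE. Qed.

Lemma compositions_geq_uniq q n : uniq (compositions_geq q n).
Proof. by rewrite (map_inj_uniq val_inj) enum_uniq. Qed.

Lemma mem_compositions_geq q n s :
  (s \in compositions_geq q n) = composition_geq q n s.
Proof.
apply/mapP/andP => [[c c_in ->]|[s_comp s_ge]].
  by split; [exact: (valP c) | rewrite mem_enum inE in c_in].
by exists (Composition s_comp); rewrite ?mem_enum ?inE.
Qed.

(** Reduces each count to exhibiting a list: duplicate-free lists with the same members are
    permutations of each other. *)
Lemma u_size q n (L : seq (seq nat)) :
  uniq L -> (forall s, (s \in L) = composition_geq q n s) -> u q n = size L.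
Proof.
move=> L_uniq memL; rewrite -size_compositions_geq; apply: perm_size.
apply: uniq_perm => // [|s]; first exact: compositions_geq_uniq.
by rewrite mem_compositions_geq memL.
Qed.

Lemma u_lt q n : 0 < q -> n < q -> u q n = 0.
Proof.
move=> q_gt0 lt_nq; rewrite (@u_size _ _ [::]) // => s.
by rewrite composition_geqE // in_nil; case: s => //= a s; lia.
Qed.

Lemma u_diag q : 0 < q -> u q q = 1.
Proof.
move=> q_gt0; rewrite (@u_size _ _ [:: [:: q]]) // => s.
rewrite composition_geqE // inE; case: s => [|a [|b s]] //=.
  by rewrite eqseq_cons eqxx; lia.
(* Two parts already sum to at least [q + q], which exceeds [q]. *)
by rewrite eqseq_cons andbF; lia.
Qed.

Lemma u_rec q n : 0 < q -> q < n -> u q n = u q (n - 1) + u q (n - q).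
Proof.
move=> q_gt0 lt_qn.
pose L1 := [seq incr_nth s 0 | s <- compositions_geq q (n - 1)].
pose L2 := [seq q :: s | s <- compositions_geq q (n - q)].
have memL1 s : (s \in L1) = composition_geq q n s && (head 0 s != q).
  rewrite composition_geqE //; apply/mapP/idP => [[t]|].
    rewrite mem_compositions_geq composition_geqE //.
    by case: t => //= a t h ->/=; lia.
  (* Here [a > q], so [a.-1] is still at least [q] and raising it restores [a]. *)
  case: s => //= a s h; exists (a.-1 :: s); last by congr (_ :: _); lia.
  by rewrite mem_compositions_geq composition_geqE //=; lia.
have memL2 s : (s \in L2) = composition_geq q n s && (head 0 s == q).
  rewrite composition_geqE //; apply/mapP/idP => [[t]|].
    by rewrite mem_compositions_geq composition_geqE // => h -> /=; lia.
  case: s => //= a s h; exists s; last by congr (_ :: _); lia.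
  rewrite mem_compositions_geq composition_geqE //.
  (* An empty tail would force [n = q], against [q < n]. *)
  by case: s h => //=; lia.
have L1_uniq : uniq L1.
  (* Injectivity holds only among nonempty lists: raising the head sends both [[::]] and [[:: 0]] to
     [[:: 1]]. *)
  rewrite map_inj_in_uniq ?compositions_geq_uniq // => s t.
  rewrite !mem_compositions_geq !composition_geqE //.
  by case: s t => [|a s] [|b t] //= _ _ [-> ->].
have L2_uniq : uniq L2.
  by rewrite map_inj_uniq ?compositions_geq_uniq // => s t [].
have L12_disjoint : ~~ has (mem L1) L2.
  apply/hasPn => s; rewrite memL2 => /andP[_ s_q].
  by rewrite inE memL1 s_q andbF.
rewrite (@u_size _ _ (L1 ++ L2)) => [||s].
- by rewrite size_cat; congr addn; rewrite size_map size_compositions_geq.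
- by rewrite cat_uniq L1_uniq L2_uniq L12_disjoint.
- by rewrite mem_cat memL1 memL2 -andb_orr orNb andbT.
Qed.

Theorem theorem8 (q : nat) (hq : 0 < q) (n : nat) (hn : 0 < n) :
  u q n = if n < q then 0
          else if n == q then 1
          else u q (n - 1) + u q (n - q).
Proof.
case: ltngtP => [lt_nq | lt_qn | ->].
- exact: u_lt.
- exact: u_rec.
- exact: u_diag.
Qed.
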